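(* Let $A\in\mathbb{C}^{m\times n}$, $E\in\mathbb{C}^{n\times n}$ and $F\in\mathbb{C}^{m\times m}$. The matrix equations $$XAX=X,\qquad XA=E,\qquad AX=F$$ have a common solution $X\in\mathbb{C}^{n\times m}$ if and only if $$EA^{(1)}A=E,\quad AA^{(1)}F=F,\quad AE=FA,\quad E^2=E,\quad\text{and}\quad F^2=F$$ for some $A^{(1)}\in A\{1\}$, in which case the common solution $X$ is unique and is given by $$X=EA^{(1)}F.$$
   Context: For $A\in\mathbb{C}^{m\times n}$, $A\{1\}$ denotes the set of all inner inverses of $A$, i.e. all $Y\in\mathbb{C}^{n\times m}$ with $AYA=A$; an element of $A\{1\}$ is denoted $A^{(1)}$. (The solution $X$ of the three equations, when it exists, is called the $EF$-inverse of $A$ and denoted $A^{(E,F)}$.) *)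

(* Defs.v *)
From HB Require Import structures.
From mathcomp Require Import all_boot all_order all_algebra.
From mathcomp Require Import reals.
From mathcomp Require Import complex.

Set Implicit Arguments.
Unset Strict Implicit.
Unset Printing Implicit Defensive.

Import GRing.Theory.
Local Open Scope ring_scope.

Definition inner_inverses (K : fieldType) (m n : nat) (A : 'M[K]_(m, n)) :
    {pred 'M[K]_(n, m)} :=
  [pred Y | A *m Y *m A == A].

Definition is_EF_inverse (K : fieldType) (m n : nat) (A : 'M[K]_(m, n))
    (E : 'M[K]_n) (F : 'M[K]_m) (X : 'M[K]_(n, m)) : Prop :=
  [/\ X *m A *m X = X, X *m A = E & A *m X = F].

(* Main.v *)
Require Import Defs.
From HB Require Import structures.
From mathcomp Require Import all_boot all_order all_algebra.
From mathcomp Require Import reals.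
From mathcomp Require Import complex.

Set Implicit Arguments.
Unset Strict Implicit.
Unset Printing Implicit Defensive.

Import GRing.Theory.
Local Open Scope ring_scope.

(** The three equations determine E and F from X and A.  After replacing E by
    X A and F by A X, the relation A E = F A is associativity, and each other
    identity of the criterion follows from X A X = X or A Y A = A; an arbitrary
    inner inverse Y of A will do, and one exists over any field.

    Conversely, put X = E Y F.  The intertwining
    relation A E = F A lets A pass through, so that X A = E Y A E = E E = E and
    A X = F A Y F = F F = F, whence X A X = E X = X.  Uniqueness holds because
    any solution Z satisfies E Y F = E Y A Z = E Z = Z A Z = Z. *)

Lemma pinvmx_inner_inverse (K : fieldType) (m n : nat) (A : 'M[K]_(m, n)) :
  pinvmx A \in inner_inverses A.
Proof. by rewrite inE mulmxKpV. Qed.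

(** Necessity in its strong form: the identities hold for every inner inverse
    [Y], since [Y] only ever occurs inside [A *m Y *m A] once [E] and [F] are
    expanded. *)
Lemma EF_inverse_conditions (K : fieldType) (m n : nat) (A : 'M[K]_(m, n))
    (E : 'M[K]_n) (F : 'M[K]_m) (X Y : 'M[K]_(n, m)) :
  Y \in inner_inverses A -> is_EF_inverse A E F X ->
  [/\ E *m Y *m A = E, A *m Y *m F = F, A *m E = F *m A,
      E *m E = E & F *m F = F].
Proof.
rewrite inE => /eqP AYA [XAX <- <-]; split.
- by rewrite -!mulmxA (mulmxA A) AYA.
- by rewrite mulmxA AYA.
- by rewrite mulmxA.
- by rewrite mulmxA XAX.
- by rewrite -mulmxA (mulmxA X) XAX.
Qed.

(** The relation [A *m E = F *m A] moves [A] across the outer factor of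
    [E *m Y *m F], next to [Y], where one of the two absorption identities
    removes it; idempotence then collapses what is left. *)
Lemma EF_inverse_formula (K : fieldType) (m n : nat) (A : 'M[K]_(m, n))
    (E : 'M[K]_n) (F : 'M[K]_m) (Y : 'M[K]_(n, m)) :
  E *m Y *m A = E -> A *m Y *m F = F -> A *m E = F *m A ->
  E *m E = E -> F *m F = F -> is_EF_inverse A E F (E *m Y *m F).
Proof.
move=> EYA AYF AE EE FF.
have XA : E *m Y *m F *m A = E by rewrite -mulmxA -AE mulmxA EYA.
split=> //; first by rewrite XA !mulmxA EE.
by rewrite !mulmxA AE -!mulmxA (mulmxA A) AYF.
Qed.

(** The formula does not mention the solution [Z], so this lemma is the
    uniqueness of the EF-inverse. *)
Lemma EF_inverse_eq_formula (K : fieldType) (m n : nat) (A : 'M[K]_(m, n))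
    (E : 'M[K]_n) (F : 'M[K]_m) (Y Z : 'M[K]_(n, m)) :
  E *m Y *m A = E -> is_EF_inverse A E F Z -> E *m Y *m F = Z.
Proof. by move=> EYA [ZAZ ZA <-]; rewrite mulmxA EYA -ZA. Qed.

Theorem theorem2p4 (R : realType) (m n : nat) (A : 'M[R[i]]_(m, n))
    (E : 'M[R[i]]_n) (F : 'M[R[i]]_m) :
  let conditions (Y : 'M[R[i]]_(n, m)) : Prop :=
    [/\ E *m Y *m A = E, A *m Y *m F = F, A *m E = F *m A,
        E *m E = E & F *m F = F] in
  ((exists X : 'M[R[i]]_(n, m), is_EF_inverse A E F X) <->
   (exists2 Y : 'M[R[i]]_(n, m), Y \in inner_inverses A & conditions Y)) /\
  (forall Y : 'M[R[i]]_(n, m), Y \in inner_inverses A -> conditions Y ->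
     unique (is_EF_inverse A E F) (E *m Y *m F)).
Proof.
move=> conditions; split; first split.
- case=> X solX; exists (pinvmx A); first exact: pinvmx_inner_inverse.
  exact: EF_inverse_conditions (pinvmx_inner_inverse A) solX.
- case=> Y _ [EYA AYF AE EE FF]; exists (E *m Y *m F).
  exact: EF_inverse_formula.
- move=> Y _ [EYA AYF AE EE FF]; split; first exact: EF_inverse_formula.
  by move=> Z; apply: EF_inverse_eq_formula.
Qed.
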